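(* Let $n \ge 3$ and let $q \in \mathbb{C}\setminus\{0\}$ with $q \notin \{-1,1\}$. Then there is no linear transformation $\varphi : \mathbb{C}^{n\times n} \to \mathbb{C}^{n\times n}$ such that $\mathrm{P}_q(X) = \det(\varphi(X))$ for all $X \in \mathbb{C}^{n\times n}$, and there is no linear transformation $\varphi : \mathbb{C}^{n\times n} \to \mathbb{C}^{n\times n}$ such that $\mathrm{P}_q(X) = \operatorname{per}(\varphi(X))$ for all $X \in \mathbb{C}^{n\times n}$.
   Context: For $q \in \mathbb{C}\setminus\{0\}$ and $A = [a_{i,j}] \in \mathbb{C}^{n\times n}$, the $q$-permanent is $\mathrm{P}_q(A) = \sum_{\sigma \in \mathfrak{S}_n} q^{\ell(\sigma)} \prod_{i=1}^n a_{i,\sigma(i)}$, where $\mathfrak{S}_n$ is the symmetric group and $\ell(\sigma) = \#\{(i,j) : i<j,\ \sigma(i)>\sigma(j)\}$ is the number of inversions of $\sigma$. Thus $\mathrm{P}_1 = \operatorname{per}$ and $\mathrm{P}_{-1} = \det$. *)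

(* Defs.v *)
From mathcomp Require Import all_boot all_order all_fingroup all_algebra.

Set Implicit Arguments.
Unset Strict Implicit.
Unset Printing Implicit Defensive.

Import GRing.Theory.
Local Open Scope ring_scope.

Definition inversions (n : nat) (s : 'S_n) : nat :=
  #|[set p : 'I_n * 'I_n | (p.1 < p.2)%N && (s p.2 < s p.1)%N]|.

Definition qpermanent (K : comNzRingType) (n : nat) (q : K) (A : 'M[K]_n) : K :=
  \sum_(s : 'S_n) q ^+ inversions s * \prod_(i < n) A i (s i).

Definition permanent (K : comNzRingType) (n : nat) (A : 'M[K]_n) : K :=
  \sum_(s : 'S_n) \prod_(i < n) A i (s i).

Lemma qpermanent1 (K : comNzRingType) (n : nat) (A : 'M[K]_n) :
  qpermanent 1 A = permanent A.
Proof. by apply: eq_bigr => s _; rewrite expr1n mul1r. Qed.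

(* Main.v *)
Require Import Defs.
From mathcomp Require Import all_boot all_order all_fingroup all_algebra.
From mathcomp Require Import complex reals ring.

Set Implicit Arguments.
Unset Strict Implicit.
Unset Printing Implicit Defensive.

Import GRing.Theory Num.Theory.
Local Open Scope ring_scope.

(* If P_q = g o phi with g = det or g = per, then phi is invertible, because every
   entry occurs in P_q with a nonzero coefficient.  Call A and B flat for f when
   the mixed second difference f(Y+A+B) - f(Y+A) - f(Y+B) + f(Y) vanishes for all
   Y; phi preserves this relation.  Two matrix units in the same row or column
   are flat for P_q, while flatness for g forces the polarised 2x2 minors
   (subdeterminants, or subpermanents) to vanish.  Hence the images of the units
   of a row or of a column form a family of rank-one matrices with a common row
   or column space, which for per is spanned by a standard basis vector.  The
   n x n grid of these families forces phi(E_ij) = d_ij u_i^T v_j up to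
   transposition, so that
   q^inv(s) = c (+-1)^s prod_i d_(i,s(i)) for every permutation s.  Multiplying
   over the even and the odd permutations of three indices gives q = +-1. *)

(** * Flatness and polarised 2x2 minors of weighted permanents *)

Definition flat (K : comNzRingType) n (f : 'M[K]_n -> K) (A B : 'M[K]_n) :=
  forall Y, f (Y + A + B) + f Y = f (Y + A) + f (Y + B).

(** The weights cover [P_q], det and per at once; restricting the product to [P] allows rows to be
    removed by differencing. *)
Definition wperm (K : comNzRingType) n (w : 'S_n -> K) (P : {set 'I_n})
    (Y : 'M[K]_n) : K :=
  \sum_(s : 'S_n) w s * \prod_(i in P) Y i (s i).

Section Flatness.
Variables (K : comNzRingType) (n : nat).
Implicit Types (w : 'S_n -> K) (P : {set 'I_n}) (A B Y : 'M[K]_n) (s : 'S_n).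

(* Differencing at a matrix unit selects the permutations through that cell and
   removes its row, so iterating it isolates a single 2x2 minor. *)
Lemma wperm_delta w P Y i j : i \in P ->
  wperm w P (Y + delta_mx i j) =
  wperm w P Y + wperm (fun s => w s *+ (s i == j)) (P :\ i) Y.
Proof.
move=> iP; rewrite /wperm -big_split; apply: eq_bigr => s _ /=.
rewrite (big_setD1 i) //= [in RHS](big_setD1 i) //= !mxE eqxx /=.
rewrite (eq_bigr (fun k => Y k (s k))); last first.
  by move=> k; rewrite !inE !mxE => /andP[/negPf -> _]; rewrite addr0.
case: eqP => _ /=; last by rewrite !mulr0n mul0r !addr0.
by rewrite mulr1n; ring.
Qed.

Lemma flat_wperm_delta w P A B i j : i \in P -> flat (wperm w P) A B ->
  flat (wperm (fun s => w s *+ (s i == j)) (P :\ i)) A B.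
Proof.
move=> iP fAB Y; have := fAB (Y + delta_mx i j).
rewrite !(addrAC _ (delta_mx i j)) !wperm_delta // => eYE.
by apply: (addrI (wperm w P (Y + A + B) + wperm w P Y)); rewrite addrACA eYE fAB addrACA.
Qed.

(** Differencing at the unit [(m, t m)] for each row [m] of [l] leaves the permutations that agree
    with [t] on [l]. *)
Lemma flat_wperm_restrict w A B (t : 'S_n) (l : seq 'I_n) :
  uniq l -> flat (wperm w [set: 'I_n]) A B ->
  flat (wperm (fun s => w s *+ all (fun m => s m == t m) l)
     [set m | m \notin l]) A B.
Proof.
move=> + fAB; elim: l => [_|m l IHl /= /andP[ml /IHl {}IHl]].
  suff -> : [set m : 'I_n | m \notin [::]] = [set: 'I_n] by [].
  by apply/setP => m; rewrite !inE.
have -> : [set k | k \notin m :: l] = [set k | k \notin l] :\ m.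
  by apply/setP => k; rewrite !inE negb_or.
have ml' : m \in [set k | k \notin l] by rewrite inE.
have {ml'} IHm := flat_wperm_delta (t m) ml' IHl; move=> Y.
have E X : wperm (fun s => w s *+ ((s m == t m) && all (fun m => s m == t m) l))
    ([set k | k \notin l] :\ m) X =
  wperm (fun s => w s *+ all (fun m => s m == t m) l *+ (s m == t m))
    ([set k | k \notin l] :\ m) X.
  by apply: eq_bigr => s _; rewrite -mulrnA mulnb andbC.
by rewrite !E IHm.
Qed.

(** Such an [s] must map [{i, k}] onto [{t i, t k}], which leaves two choices. *)
Lemma perm_eq_off2 (i k : 'I_n) s (t : 'S_n) : i != k ->
  (forall m, m != i -> m != k -> s m = t m) ->
  s = t \/ s = (tperm i k * t)%g.
Proof.
move=> ik st.
have st' m : s m = t i -> m = i \/ m = k.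
  have [-> _|mi] := eqVneq m i; first by left.
  have [-> _|mk] := eqVneq m k; first by right.
  by rewrite st // => /perm_inj; left.
have {}st' m : s m = t k -> m = i \/ m = k.
  have [-> _|mi] := eqVneq m i; first by left.
  have [-> _|mk] := eqVneq m k; first by right.
  by rewrite st // => /perm_inj; right.
have img m : m = i \/ m = k -> s m = t i \/ s m = t k.
  move=> mik; set x := (t^-1)%g (s m).
  have tx : t x = s m by rewrite permKV.
  have [<-|xi] := eqVneq x i; first by left.
  have [<-|xk] := eqVneq x k; first by right.
  move: tx; rewrite -st // => /perm_inj xm.
  by case: mik xi xk => <-; rewrite xm eqxx.
have [si|si] := img i (or_introl erefl).
  left; apply/permP => m.
  have [->//|mi] := eqVneq m i; have [->|mk] := eqVneq m k; last exact: st.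
  have [sk|//] := img k (or_intror erefl).
  by move: ik; rewrite (perm_inj (etrans si (esym sk))) eqxx.
right; apply/permP => m; rewrite permM.
have [->|mi] := eqVneq m i; first by rewrite tpermL.
have [->|mk] := eqVneq m k; last by rewrite tpermD 1?eq_sym // st.
rewrite tpermR; have [//|sk] := img k (or_intror erefl).
by move: ik; rewrite (perm_inj (etrans si (esym sk))) eqxx.
Qed.

(** Once [t] is prescribed outside [i] and [k], only two permutations survive and the function
    becomes a quadratic form in four entries. *)
Lemma flat_wperm_minor w A B (t : 'S_n) i k : i != k ->
  flat (wperm w [set: 'I_n]) A B ->
  w t * (A i (t i) * B k (t k) + B i (t i) * A k (t k)) +
  w (tperm i k * t)%g * (A i (t k) * B k (t i) + B i (t k) * A k (t i)) = 0.
Proof.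
move=> ik /(flat_wperm_restrict t (enum_uniq (~: [set i; k]))).
have -> : [set m | m \notin enum (~: [set i; k])] = [set i; k].
  by apply/setP => m; rewrite !inE mem_enum !inE negbK.
set w' := fun s => _.
have w't : w' t = w t.
  by rewrite /w'; have /allP -> : {in enum (~: [set i; k]), forall m, t m == t m}.
have w'tik : w' (tperm i k * t)%g = w (tperm i k * t)%g.
  rewrite /w'; suff -> : all (fun m => (tperm i k * t)%g m == t m)
    (enum (~: [set i; k])) by [].
  apply/allP => m; rewrite mem_enum !inE negb_or => /andP[mi mk].
  by rewrite permM tpermD 1?eq_sym.
have tikt : (tperm i k * t)%g != t.
  apply/eqP => /permP /(_ i); rewrite permM tpermL => /perm_inj ki.
  by move: ik; rewrite ki eqxx.
have E Y : wperm w' [set i; k] Y = w t * (Y i (t i) * Y k (t k)) +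
    w (tperm i k * t)%g * (Y i (t k) * Y k (t i)).
  rewrite /wperm (bigD1 t) //= (bigD1 (tperm i k * t)%g) //=.
  rewrite [X in _ + (_ + X)]big1 ?addr0 => [|s /andP[st stik]].
    by rewrite !big_setU1 ?inE //= !big_set1 w't w'tik !permM tpermL tpermR.
  rewrite /w'; case: allP => [st'|_]; last by rewrite mulr0n mul0r.
  have [] : s = t \/ s = (tperm i k * t)%g; last 2 first.
  - by move=> est; rewrite est eqxx in st.
  - by move=> est; rewrite est eqxx in stik.
  apply: perm_eq_off2 => // m mi mk; apply/eqP/st'.
  by rewrite mem_enum !inE negb_or mi mk.
(* At [Y = 0] the mixed difference of a quadratic form is its polar form. *)
move=> /(_ 0); rewrite !E !add0r !mxE => e.
by apply: (addrI (w t * (A i (t i) * A k (t k) + B i (t i) * B k (t k)) +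
  w (tperm i k * t)%g * (A i (t k) * A k (t i) + B i (t k) * B k (t i))));
  rewrite addr0 [RHS](_ : _ = w t * (A i (t i) * A k (t k)) +
    w (tperm i k * t)%g * (A i (t k) * A k (t i)) + (w t * (B i (t i) * B k (t k)) +
    w (tperm i k * t)%g * (B i (t k) * B k (t i)))); [rewrite -e; ring | ring].
Qed.

Lemma flat_wperm_line w i j i' j' : i = i' \/ j = j' ->
  flat (wperm w [set: 'I_n]) (delta_mx i j) (delta_mx i' j').
Proof.
move=> line Y; rewrite /wperm -!big_split; apply: eq_bigr => s _ /=.
rewrite -!mulrDr; congr (_ * _).
(* A permutation meets a row or a column in one cell, so each product is affine in the entries of
   the line; [i0] is the row of that cell. *)
have [i0 i0P] : exists i0, forall m, m != i0 ->
    (delta_mx i j : 'M[K]_n) m (s m) = 0 /\ (delta_mx i' j' : 'M[K]_n) m (s m) = 0.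
  case: line => <-.
    by exists i => m /negPf mi; rewrite !mxE mi.
  exists (s^-1 j)%g => m /negPf mj.
  suff smj : s m == j = false by rewrite !mxE smj !andbF.
  by apply: contraFF mj => /eqP <-; rewrite permK.
rewrite !(bigD1 (P := mem [set: 'I_n]) i0) ?inE //=.
rewrite !mxE; set x := \prod_(m | _) _; set y := \prod_(m | _) _.
set z := \prod_(m | _) _; set t := \prod_(m | _) _.
have off m : (m \in [set: 'I_n]) && (m != i0) ->
    (delta_mx i j : 'M[K]_n) m (s m) = 0 /\ (delta_mx i' j' : 'M[K]_n) m (s m) = 0.
  by move=> /andP[_ /i0P].
have -> : x = y.
  by apply: eq_bigr => m /off[]; rewrite !mxE => eA eB; rewrite eA eB !addr0.
have -> : z = y.
  by apply: eq_bigr => m /off[]; rewrite !mxE => eA eB; rewrite eA addr0.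
have -> : t = y.
  by apply: eq_bigr => m /off[]; rewrite !mxE => eA eB; rewrite eB addr0.
ring.
Qed.
End Flatness.

Lemma perm_two_points n (i k j l : 'I_n) : i != k -> j != l ->
  exists2 t : 'S_n, t i = j & t k = l.
Proof.
move=> ik jl; exists (tperm i j * tperm (tperm i j k) l)%g; rewrite permM; last first.
  by rewrite tpermL.
rewrite (tpermL i j); apply: tpermD; last by rewrite eq_sym.
by rewrite -{2}(tpermL i j) (inj_eq perm_inj) eq_sym.
Qed.

(** Polarised minors for [e = -1], polarised subpermanents for [e = 1]; at [A = B] the expression is
    twice the minor or subpermanent. *)
Definition polar_minors (K : comNzRingType) n (e : K) (A B : 'M[K]_n) :=
  forall i k j l, i != k -> j != l ->
    A i j * B k l + B i j * A k l + e * (A i l * B k j + B i l * A k j) = 0.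

(** The row spaces lie in a common line; common column lines are expressed by transposing the
    family. [P] is there to record that [v] is a standard basis vector in the case of per. *)
Definition pencil (K : fieldType) n (P : 'rV[K]_n -> Prop) m
    (M : 'I_m -> 'M[K]_n) :=
  exists2 v, P v & forall j, (M j <= v)%MS.

(** * Rank-one matrices and the pencils of the determinant *)

Section RankOne.
Variables (K : fieldType) (n : nat).
Hypothesis two_neq0 : 2%:R != 0 :> K.
Implicit Types (A B : 'M[K]_n) (u v : 'rV[K]_n).

Lemma submx_rank1 m p (A : 'M[K]_(m, n)) (B : 'M[K]_(p, n)) :
  (\rank B <= 1)%N -> A != 0 -> (A <= B)%MS -> (B <= A)%MS.
Proof.
move=> rB A0 AB; rewrite -(geq_leqif (mxrank_leqif_sup AB)).
by apply: leq_trans rB _; rewrite lt0n mxrank_eq0.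
Qed.

(** Around a nonzero pivot, the vanishing minors make [A] the product of the pivot column and the
    scaled pivot row. *)
Lemma polar_minors_rank1 A : polar_minors (-1) A A -> (\rank A <= 1)%N.
Proof.
move=> pA; have [->|] := eqVneq A 0; first by rewrite mxrank0.
case/matrix0Pn => i0 [j0 A0].
suff -> : A = col j0 A *m ((A i0 j0)^-1 *: row i0 A).
  by apply: leq_trans (mxrankM_maxl _ _) (rank_leq_col _).
apply/matrixP => i j; rewrite !mxE big_ord1 !mxE.
have [->|ii0] := eqVneq i i0; first by rewrite mulrA mulfV ?mul1r.
have [->|jj0] := eqVneq j j0; first by rewrite mulVf ?mulr1.
have e : A i j * A i0 j0 = A i j0 * A i0 j.
  apply: (mulfI two_neq0); apply/eqP; rewrite -subr_eq0; apply/eqP.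
  by rewrite -(pA _ _ _ _ ii0 jj0); ring.
by rewrite mulrCA mulrA -mulrA -e mulrC mulfK.
Qed.

Lemma rank1_outer A : (\rank A <= 1)%N -> exists (a : 'cV[K]_n) (b : 'rV_n), A = a *m b.
Proof.
move=> rA; have : (A <= row_base A)%MS by rewrite eq_row_base.
case/submxP => D AD; case: (\rank A) (row_base A) D AD rA => [|[|//]] b a AD _.
  exists 0, 0; rewrite mul0mx AD; apply/matrixP => i j.
  by rewrite !mxE big_ord0.
by exists a, b.
Qed.

Lemma cross_submx m (b d : 'rV[K]_m) : b != 0 ->
  (forall j l, b 0 j * d 0 l = d 0 j * b 0 l) -> (d <= b)%MS.
Proof.
move=> /matrix0Pn [i [j]]; rewrite ord1 => bj0 cr.
apply/sub_rVP; exists (d 0 j / b 0 j); apply/rowP => l; rewrite mxE.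
by rewrite mulrAC -cr mulrAC mulfV ?mul1r.
Qed.

(** For outer products [a b] and [c d] the polarised minor factors into a 2x2 minor of [(a, c)]
    times one of [(b, d)], so one of the two pairs is parallel. *)
Lemma polar_minors_sub A B : A != 0 -> polar_minors (-1) A A ->
  polar_minors (-1) B B -> polar_minors (-1) A B ->
  (B <= A)%MS \/ (B^T <= A^T)%MS.
Proof.
move=> A0 /polar_minors_rank1 rA /polar_minors_rank1 rB pAB.
have [a [b eA]] := rank1_outer rA; have [c [d eB]] := rank1_outer rB.
have a0 : a^T != 0.
  by apply: contraNneq A0 => /(congr1 trmx); rewrite eA trmxK trmx0 => ->; rewrite mul0mx.
have b0 : b != 0 by apply: contraNneq A0 => b0; rewrite eA b0 mulmx0.
have Ab : (b <= A)%MS.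
  by apply: submx_rank1 => //; [exact: rank_leq_row | rewrite eA submxMl].
have Aa : (a^T <= A^T)%MS.
  apply: submx_rank1; [exact: rank_leq_row | by rewrite trmx_eq0 |].
  by rewrite eA trmx_mul submxMl.
have cr i k j l : (a i 0 * c k 0 - c i 0 * a k 0) * (b 0 j * d 0 l - d 0 j * b 0 l) = 0.
  have [->|ik] := eqVneq i k; first by ring.
  have [->|jl] := eqVneq j l; first by ring.
  by rewrite -(pAB _ _ _ _ ik jl) eA eB !mxE !big_ord1; ring.
have [/forallP ac|] := boolP [forall i, forall k, a i 0 * c k 0 == c i 0 * a k 0].
  right; apply: submx_trans Aa; rewrite eB trmx_mul; apply: submx_trans (submxMl _ _) _.
  apply: cross_submx => // i k; rewrite !mxE; apply/eqP.
  by move/forallP: (ac i).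
case/forallPn => i /forallPn[k]; rewrite -subr_eq0 => /negPf ack.
left; apply: submx_trans Ab; rewrite eB; apply: submx_trans (submxMl _ _) _.
apply: cross_submx => // j l; apply/eqP; rewrite -subr_eq0.
by have /eqP := cr i k j l; rewrite mulf_eq0 ack.
Qed.

Lemma det_pencil m (M : 'I_m.+1 -> 'M[K]_n) : (forall j, M j != 0) ->
  (forall j k, polar_minors (-1) (M j) (M k)) ->
  pencil (fun=> True) M \/ pencil (fun=> True) (fun j => (M j)^T).
Proof.
move=> M0 pM; pose A := M ord0.
have [a [b eA]] := rank1_outer (polar_minors_rank1 (pM ord0 ord0)).
have sA j : (M j <= A)%MS \/ ((M j)^T <= A^T)%MS
  by exact: polar_minors_sub (M0 _) (pM _ _) (pM _ _) (pM _ _).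
have [/forallP all_row|/forallPn[j jA]] := boolP [forall j, M j <= A]%MS.
  by left; exists b => // j; apply: submx_trans (all_row j) _; rewrite /A eA submxMl.
right; exists a^T => // k; apply: (@submx_trans _ _ _ _ _ _ A^T); last first.
  by rewrite /A eA trmx_mul submxMl.
have [kA|//] := sA k; have [jA'|jA'] := sA j; first by rewrite jA' in jA.
have rT i : (\rank (M i)^T <= 1)%N by rewrite mxrank_tr polar_minors_rank1.
(* [M k] has the row line of [A], which [M j] lacks; hence [M k] and [M j] can only share their
   column line, which is that of [A]. *)
have [jk|jk] := polar_minors_sub (M0 k) (pM k k) (pM j j) (pM k j).
  by rewrite (submx_trans jk kA) in jA.
apply: submx_trans jA'; apply: submx_rank1 => //.
by rewrite trmx_eq0.
Qed.

Lemma outer_sub A u v : (A <= v)%MS -> (A^T <= u)%MS ->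
  exists d, A = d *: (u^T *m v).
Proof.
case/submxP => a eA; case/submxP => b eB.
have [v0|/matrix0Pn[i [j]]] := eqVneq v 0.
  by exists 0; rewrite scale0r eA v0 mulmx0.
(* Column [j] of [A] is both [v 0 j] times [a] and [b j 0] times [u^T]. *)
rewrite ord1 => vj0; exists (b j 0 / v 0 j).
rewrite [LHS]eA scalemxAl; congr (_ *m _); apply/colP => k.
have /(congr1 trmx)/matrixP/(_ k j) := eB.
rewrite trmxK trmx_mul eA !mxE !big_ord1 !mxE => e.
by rewrite -mulrA mulrCA (mulrC (b j 0)) -e mulrC mulfK.
Qed.
End RankOne.

(** * Vanishing subpermanents and the pencils of the permanent *)

Section Permanental.
Variables (K : fieldType) (n : nat).
Hypothesis two_neq0 : 2%:R != 0 :> K.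
Implicit Types (A B X Y : 'M[K]_n).

Lemma polar_minorsD (e : K) A B C :
  polar_minors e A B -> polar_minors e A C -> polar_minors e A (B + C).
Proof.
move=> pB pC i k j l ik jl; rewrite !mxE -[RHS](addr0 0).
by rewrite -{1}(pB _ _ _ _ ik jl) -(pC _ _ _ _ ik jl); ring.
Qed.

Lemma polar_minorsC (e : K) A B : polar_minors e A B -> polar_minors e B A.
Proof. by move=> pB i k j l ik jl; rewrite -(pB _ _ _ _ ik jl); ring. Qed.

Lemma polar_minors_tr (e : K) A B :
  polar_minors e A B -> polar_minors e A^T B^T.
Proof. by move=> pB i k j l ik jl; rewrite !mxE -(pB _ _ _ _ jl ik); ring. Qed.

(** The linear system in [x] and [y] has determinant [a * d - b * c], which equals [2 * (a * d)]. *)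
Lemma perm2_solve (a b c d x y : K) : a != 0 -> d != 0 ->
  a * d + b * c = 0 -> a * y + b * x = 0 -> c * y + d * x = 0 ->
  x = 0 /\ y = 0.
Proof.
move=> a0 d0 bc e1 e2.
have D0 : 2 * (a * d) != 0 by rewrite !mulf_neq0.
have e3 : 2 * (a * d) = a * d - b * c.
  by rewrite -[LHS]subr0 -bc; ring.
split; apply: (mulfI D0); rewrite mulr0 e3.
  transitivity (a * (c * y + d * x) - c * (a * y + b * x)); first by ring.
  by rewrite e1 e2; ring.
transitivity (d * (a * y + b * x) - b * (c * y + d * x)); first by ring.
by rewrite e1 e2; ring.
Qed.

(** Row [m] of [X] vanishes first: columns [j] and [l] by [perm2_solve], the others against the
    pivot [X i j]. The relations for row [m] of [Y] then take the same form. *)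
Lemma permanental_block_row X Y i k j l m p : polar_minors 1 X X ->
  polar_minors 1 X Y -> i != k -> j != l -> X i j != 0 -> X k l != 0 ->
  m != i -> m != k -> Y m p = 0.
Proof.
move=> pX pXY ik jl Xij Xkl mi mk.
have half a c b d : a != c -> b != d -> X a b * X c d + X a d * X c b = 0.
  by move=> ac bd; apply: (mulfI two_neq0); rewrite mulr0 -(pX _ _ _ _ ac bd); ring.
have [im km] : i != m /\ k != m by rewrite ![_ == m]eq_sym.
have h0 := half _ _ _ _ ik jl.
have [Xmj Xml] : X m j = 0 /\ X m l = 0.
  by apply: perm2_solve Xij Xkl h0 _ _; rewrite 1?[X in X = 0]addrC half // eq_sym.
have Xm q : X m q = 0.
  have [->//|qj] := eqVneq q j; have [->//|ql] := eqVneq q l.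
  apply: (mulfI Xij); rewrite mulr0 -(half i m j q im) 1?eq_sym //.
  by rewrite Xmj mulr0 addr0.
have pXm a b d : a != m -> b != d -> X a b * Y m d + X a d * Y m b = 0.
  by move=> am bd; rewrite -(pXY _ _ _ _ am bd) !Xm; ring.
have [Ymj Yml] : Y m j = 0 /\ Y m l = 0.
  by apply: perm2_solve Xij Xkl h0 _ _; rewrite 1?[X in X = 0]addrC pXm // eq_sym.
have [->//|pj] := eqVneq p j; have [->//|pl] := eqVneq p l.
apply: (mulfI Xij); rewrite mulr0 -(pXm i j p im) 1?eq_sym //.
by rewrite Ymj mulr0 addr0.
Qed.

Lemma permanental_block X Y i k j l m p : polar_minors 1 X X ->
  polar_minors 1 X Y -> i != k -> j != l -> X i j != 0 -> X k l != 0 ->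
  Y m p != 0 -> (m \in [:: i; k]) && (p \in [:: j; l]).
Proof.
move=> pX pXY ik jl Xij Xkl; apply: contraNT; rewrite negb_and !inE !negb_or.
case/orP => /andP[m1 m2]; apply/eqP.
  exact: permanental_block_row pX pXY ik jl Xij Xkl m1 m2.
have -> : Y m p = Y^T p m by rewrite mxE.
by apply: permanental_block_row (polar_minors_tr pX) (polar_minors_tr pXY)
  jl ik _ _ m1 m2; rewrite mxE.
Qed.

Definition indep m (M : 'I_m -> 'M[K]_n) :=
  forall u : 'I_m -> K, \sum_x u x *: M x = 0 -> forall x, u x = 0.

Lemma indep_neq0 m (M : 'I_m -> 'M[K]_n) : indep M -> forall x, M x != 0.
Proof.
move=> indM x; apply/eqP => M0.
have S0 : \sum_y (y == x)%:R *: M y = 0.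
  rewrite (bigD1 x) //= M0 scaler0 add0r big1 // => y /negPf ->.
  by rewrite scale0r.
by move: (indM (fun y => (y == x)%:R) S0 x) => /= /eqP; rewrite eqxx oner_eq0.
Qed.

Lemma indep_row_free m (M : 'I_m -> 'M[K]_n) d (r c : 'I_d -> 'I_n) : indep M ->
  (forall x a b, M x a b != 0 -> exists y, r y = a /\ c y = b) ->
  row_free (\matrix_(x < m, y < d) M x (r y) (c y)).
Proof.
move=> indM cover; apply: inj_row_free => v; move/rowP => vM.
apply/rowP => x; rewrite mxE; apply: (indM (v 0)); apply/matrixP => a b.
rewrite summxE mxE.
have [/existsP[z Mz]|/existsPn M0] := boolP [exists z, M z a b != 0].
  have [y [<- <-]] := cover _ _ _ Mz; have := vM y; rewrite !mxE => {2}<-.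
  by apply: eq_bigr => t _; rewrite !mxE.
rewrite big1 // => z _; rewrite mxE.
by have /negPn/eqP -> := M0 z; rewrite mulr0.
Qed.

(** All supports lie in one 2x2 block, where the polarised permanent is a nondegenerate form on a
    space of dimension 4; a totally isotropic family there has rank at most 2. *)
Lemma permanental_no_block m (M : 'I_m -> 'M[K]_n) X i k j l : (2 < m)%N ->
  indep M -> (forall x y, polar_minors 1 (M x) (M y)) ->
  polar_minors 1 X X -> (forall x, polar_minors 1 X (M x)) ->
  i != k -> j != l -> X i j != 0 -> X k l != 0 -> False.
Proof.
move=> m3 indM pM pX pXM ik jl Xij Xkl.
pose sel (s : seq 'I_n) (y : 'I_4) := nth i s y.
pose C r c := \matrix_(x < m, y < 4) M x (sel r y) (sel c y).
have block x a b : M x a b != 0 -> (a \in [:: i; k]) && (b \in [:: j; l]).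
  exact: permanental_block pX (pXM x) ik jl Xij Xkl.
(* The second matrix pairs each cell of the 2x2 block with the opposite one, so
   the product is the Gram matrix of the family for the form of the block. *)
have : C [:: i; k; i; k] [:: j; l; l; j] *m (C [:: k; i; k; i] [:: l; j; j; l])^T = 0.
  apply/matrixP => x y; rewrite !mxE.
  rewrite !big_ord_recl big_ord0 !mxE /sel /=; apply: etrans (pM x y _ _ _ _ ik jl); ring.
move/mulmx0_rank_max; rewrite mxrank_tr.
have rC r c : (forall a b, a \in [:: i; k] -> b \in [:: j; l] ->
    exists y, sel r y = a /\ sel c y = b) -> \rank (C r c) = m.
  move=> cover; apply/eqP; apply: indep_row_free => // x a b /block /andP[].
  exact: cover.
rewrite !rC => [| a b | a b].
- by rewrite leqNgt (@leq_trans (3 + 3)) // leq_add.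
- rewrite !inE => /orP[]/eqP-> /orP[]/eqP->.
  + by exists (inord 1); rewrite /sel inordK.
  + by exists (inord 3); rewrite /sel inordK.
  + by exists (inord 2); rewrite /sel inordK.
  + by exists (inord 0); rewrite /sel inordK.
- rewrite !inE => /orP[]/eqP-> /orP[]/eqP->.
  + by exists (inord 0); rewrite /sel inordK.
  + by exists (inord 2); rewrite /sel inordK.
  + by exists (inord 3); rewrite /sel inordK.
  + by exists (inord 1); rewrite /sel inordK.
Qed.

Lemma col_sub_delta A c : (forall a b, A a b != 0 -> b = c) ->
  (A <= delta_mx (0 : 'I_1) c)%MS.
Proof.
move=> Ac; suff -> : A = col c A *m delta_mx (0 : 'I_1) c by exact: submxMl.
apply/matrixP => a b; rewrite !mxE big_ord1 !mxE eqxx.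
have [->|bc] /= := eqVneq b c; first by rewrite mulr1.
by rewrite mulr0; apply/eqP; apply: contraNT bc => /Ac ->.
Qed.

Lemma per_pencil m (M : 'I_m -> 'M[K]_n) : (2 < m)%N -> indep M ->
  (forall x y, polar_minors 1 (M x) (M y)) ->
  pencil (fun v => exists c, v = delta_mx 0 c) M \/
  pencil (fun v => exists c, v = delta_mx 0 c) (fun x => (M x)^T).
Proof.
move=> m3 indM pM.
have line x y a b c d : M x a b != 0 -> M y c d != 0 -> a = c \/ b = d.
  move=> Mx My; have [->|ac] := eqVneq a c; first by left.
  have [->|bd] := eqVneq b d; first by right.
  (* Two nonzero entries off a common line are brought into one matrix: [M x], [M y], or their sum
     when each vanishes at the cell of the other. *)
  exfalso; have no X : polar_minors 1 X X -> (forall z, polar_minors 1 X (M z)) ->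
      X a b != 0 -> X c d != 0 -> False.
    by move=> pX pXM; exact: permanental_no_block m3 indM pM pX pXM ac bd.
  have [Mx0|Mx0] := eqVneq (M x c d) 0; last by apply: (no (M x)).
  have [My0|My0] := eqVneq (M y a b) 0; last by apply: (no (M y)).
  have pxy z : polar_minors 1 (M x + M y) (M z).
    by apply: polar_minorsC; apply: polar_minorsD.
  apply: (no (M x + M y)); rewrite ?mxE ?Mx0 ?My0 ?addr0 ?add0r //.
  exact: polar_minorsD.
have [x [a [b Mx]]] : exists x a b, M x a b != 0.
  have x0 : 'I_m := Ordinal (ltnW (ltnW m3)).
  have /matrix0Pn[a [b Mab]] : M x0 != 0 := indep_neq0 indM x0.
  by exists x0, a, b.
(* An entry outside row [a] must lie in column [b], and then no entry outside column [b] can be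
   collinear with both. *)
have [/existsP[y /existsP[c /existsP[d /andP[My ca]]]]|no_other] :=
    boolP [exists y, exists c, exists d, (M y c d != 0) && (c != a)].
  left; exists (delta_mx 0 b); first by exists b.
  have db : d = b.
    by have [ac|//] := line _ _ _ _ _ _ My Mx; rewrite ac eqxx in ca.
  move=> z; apply: col_sub_delta => r s Mz; apply/eqP; apply: contraNT ca => sb.
  have [<-|sd] := line _ _ _ _ _ _ Mz My; last by rewrite sd db eqxx in sb.
  by have [->|sb'] := line _ _ _ _ _ _ Mz Mx; last by rewrite sb' eqxx in sb.
right; exists (delta_mx 0 a); first by exists a.
move=> z; apply: col_sub_delta => r s; rewrite mxE => Mz.
apply/eqP; apply: contraNT no_other => sa.
by apply/existsP; exists z; apply/existsP; exists s; apply/existsP; exists r; rewrite Mz.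
Qed.
End Permanental.

(** * The grid of row and column pencils *)

Section Grid.
Variables (K : fieldType) (n : nat).
Implicit Types (u v : 'rV[K]_n).

Lemma line_eq m (A : 'M[K]_(m, n)) v v' :
  A != 0 -> (A <= v)%MS -> (A <= v')%MS -> (v <= v')%MS.
Proof.
move=> A0 Av; apply: submx_trans; exact: submx_rank1 (rank_leq_row _) A0 Av.
Qed.

Definition proportional_free (M : 'I_n -> 'I_n -> 'M[K]_n) :=
  forall i j k l c, M i j = c *: M k l -> i = k /\ j = l.

(** The cell [(i0, j0)] identifies the two lines. If row [k] and column [l] are both of column type,
    then [M i0 l] and [M k j0] share row line and column line, so they are proportional and
    [k = i0]. *)
Lemma crossing_pencils (M : 'I_n -> 'I_n -> 'M[K]_n) P i0 j0 v0 v1 :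
  (forall i j, M i j != 0) -> proportional_free M ->
  (forall i, pencil P (M i) \/ pencil P (fun j => (M i j)^T)) ->
  (forall j, pencil P (M^~ j) \/ pencil P (fun i => (M i j)^T)) ->
  (forall j, M i0 j <= v0)%MS -> (forall i, M i j0 <= v1)%MS ->
  forall i j, (M i j <= v0)%MS.
Proof.
move=> M0 Mp rows cols row0 col0.
have {col0 v1} col0 i : (M i j0 <= v0)%MS.
  exact: submx_trans (col0 i) (line_eq (M0 i0 j0) (col0 i0) (row0 j0)).
move=> k l; have [[v2 _ rowk]|[u2 _ rowk]] := rows k.
  exact: submx_trans (rowk l) (line_eq (M0 k j0) (rowk j0) (col0 k)).
have [[v3 _ coll]|[u3 _ coll]] := cols l.
  exact: submx_trans (coll k) (line_eq (M0 i0 l) (coll i0) (row0 l)).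
have MT0 i j : (M i j)^T != 0 by rewrite trmx_eq0.
have u32 : (u3 <= u2)%MS := line_eq (MT0 k l) (coll k) (rowk l).
have [d ed] := outer_sub (row0 l) (submx_trans (coll i0) u32).
have [d' ed'] := outer_sub (col0 k) (rowk j0).
have d'0 : d' != 0.
  by apply: contraNneq (M0 k j0) => d0; rewrite ed' d0 scale0r.
have [<- _] : i0 = k /\ l = j0.
  by apply: (Mp _ _ _ _ (d / d')); rewrite ed ed' scalerA divfK.
exact: row0.
Qed.

(** One row of row type forces every column to be of column type, since a crossing would confine the
    whole grid to one line; by transposition every row is then of row type. *)
Lemma grid_rank1 (M : 'I_n -> 'I_n -> 'M[K]_n) (P : 'rV[K]_n -> Prop)
    (j0 : 'I_n) i1 v1 :
  (forall i j, M i j != 0) -> proportional_free M ->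
  (forall i, pencil P (M i) \/ pencil P (fun j => (M i j)^T)) ->
  (forall j, pencil P (M^~ j) \/ pencil P (fun i => (M i j)^T)) ->
  (forall v, ~ forall i j, (M i j <= v)%MS) ->
  (forall v, ~ forall i j, ((M i j)^T <= v)%MS) ->
  (forall j, M i1 j <= v1)%MS ->
  exists d, exists2 u, (forall j, P (u j)) & exists2 v, (forall i, P (v i)) &
    forall i j, M i j = d i j *: ((u j)^T *m v i).
Proof.
move=> M0 Mp rows cols fullM fullMT row1.
have /fin_all_exists2[u Pu uM] j : exists2 u, P u & forall i, ((M i j)^T <= u)%MS.
  have [[v _ colj]|[u Pu colj]] := cols j; last by exists u.
  case: (fullM v1).
  exact: (@crossing_pencils M P i1 j v1 v M0 Mp rows cols row1 colj).
have /fin_all_exists2[v Pv vM] i : exists2 v, P v & forall j, (M i j <= v)%MS.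
  have [[v Pv rowi]|[w _ rowi]] := rows i; first by exists v.
  case: (fullMT w).
  apply: (@crossing_pencils (fun i j => (M i j)^T) P i j0 w (u j0)) => //.
  - by move=> k l; rewrite trmx_eq0.
  - move=> k l k' l' c /(congr1 trmx); rewrite linearZ /= !trmxK; exact: Mp.
  - move=> k; case: (rows k) => -[x Px xM]; [right|left]; exists x => // j.
    by rewrite trmxK.
  - move=> k; case: (cols k) => -[x Px xM]; [right|left]; exists x => // j.
    by rewrite trmxK.
have /fin_all_exists[d dM] i :
    exists d : 'I_n -> K, forall j, M i j = d j *: ((u j)^T *m v i).
  have /fin_all_exists[d dM] j : exists d, M i j = d *: ((u j)^T *m v i).
    exact: outer_sub (vM i j) (uM j i).
  by exists d.
by exists d, u => //; exists v.
Qed.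

Lemma grid_rank1_or_tr (M : 'I_n -> 'I_n -> 'M[K]_n) (P : 'rV[K]_n -> Prop)
    (i0 : 'I_n) :
  (forall i j, M i j != 0) -> proportional_free M ->
  (forall i, pencil P (M i) \/ pencil P (fun j => (M i j)^T)) ->
  (forall j, pencil P (M^~ j) \/ pencil P (fun i => (M i j)^T)) ->
  (forall v, ~ forall i j, (M i j <= v)%MS) ->
  (forall v, ~ forall i j, ((M i j)^T <= v)%MS) ->
  exists d, exists2 u, (forall i, P (u i)) & exists2 v, (forall j, P (v j)) &
    (forall i j, M i j = d i j *: ((u i)^T *m v j)) \/
    (forall i j, (M i j)^T = d i j *: ((u i)^T *m v j)).
Proof.
move=> M0 Mp rows cols fullM fullMT.
have [[v1 _ row1]|[v1 _ row1]] := rows i0.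
  have [d [u Pu [v Pv dM]]] :=
    grid_rank1 i0 M0 Mp rows cols fullM fullMT row1.
  (* [grid_rank1] attaches [v i] to row [i], so transposing its outer product exchanges [u] and
     [v]. *)
  exists d, v => //; exists u => //; right=> i j.
  by rewrite dM linearZ /= trmx_mul trmxK.
pose MT i j := (M i j)^T.
have [|||||||d [u Pu [v Pv dM]]] := @grid_rank1 MT P i0 i0 v1; last 1 first.
- exists d, v => //; exists u => //; left=> i j.
  by rewrite -[LHS]trmxK -/(MT i j) dM linearZ /= trmx_mul trmxK.
- by move=> k l; rewrite trmx_eq0.
- move=> k l k' l' c /(congr1 trmx); rewrite linearZ /= !trmxK; exact: Mp.
- move=> k; case: (rows k) => -[x Px xM]; [right|left]; exists x => // j.
  by rewrite trmxK.
- move=> k; case: (cols k) => -[x Px xM]; [right|left]; exists x => // j.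
  by rewrite trmxK.
- by [].
- by move=> v vM; apply: (fullM v) => i j; rewrite -[M i j]trmxK; apply: vM.
- by [].
Qed.
End Grid.

(** * Inversions of permutations of the first three indices *)

Section Inversions.

Lemma inversionsE n (s : 'S_n) :
  inversions s = (\sum_(i < n) \sum_(j < n) ((i < j) && (s j < s i)))%N.
Proof.
rewrite /inversions -sum1dep_card big_mkcond /= pair_big /=.
by apply: eq_bigr => -[i j] _ /=; case: (_ && _).
Qed.

Variable m : nat.
Let o0 : 'I_m.+3 := ord0.
Let o1 : 'I_m.+3 := lift ord0 ord0.
Let o2 : 'I_m.+3 := lift ord0 (lift ord0 ord0).
Let up (i : 'I_m) : 'I_m.+3 := lift ord0 (lift ord0 (lift ord0 i)).

Lemma up_surj (o : 'I_m.+3) : (2 < o)%N -> exists i, o = up i.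
Proof.
move=> o3; have o3m : (o - 3 < m)%N by rewrite ltn_subLR // addnC addn3.
exists (Ordinal o3m); apply/val_inj; rewrite /= /bump /= !add1n.
by rewrite -[LHS](subnK o3) addn3.
Qed.

Lemma inversions_head (s : 'S_m.+3) : (forall i, s (up i) = up i) ->
  inversions s = ((s o1 < s o0) + (s o2 < s o0) + (s o2 < s o1))%N.
Proof.
move=> s_up.
(* An index below 3 sent to the tail would collide with a fixed point there, so inversions occur
   only among the first three indices. *)
have low (o : 'I_m.+3) : (o < 3)%N -> (s o < 3)%N.
  move=> o3; rewrite ltnNge; apply/negP => so3.
  have [i soi] := up_surj so3; rewrite -s_up in soi.
  by rewrite (perm_inj soi) in o3.
have tail (o : 'I_m.+3) i : (o < 3)%N -> (s (up i) < s o)%N = false.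
  move=> /low so3; rewrite s_up; apply/negbTE; rewrite -leqNgt.
  by apply: leq_trans (ltnW so3) _; rewrite /= /bump /= !add1n.
rewrite inversionsE !big_ord_recl /=.
have tail0 (o : 'I_m.+3) : (o < 3)%N -> (\sum_(i < m) (s (up i) < s o))%N = 0%N.
  by move=> o3; rewrite big1 // => i _; rewrite tail.
rewrite !tail0 // !addn0 !add0n (big1 _ xpredT); last first.
  move=> i _; apply: big1 => j _; rewrite -/(up i).
  have [ij|//] := ltnP (up i) j.
  have [|k jk] := @up_surj j; first by rewrite (leq_trans _ (ltnW ij)).
  by rewrite jk !s_up -jk ltnNge (ltnW ij).
by rewrite !addn0.
Qed.

Lemma prod_head (K : comNzRingType) (d : 'I_m.+3 -> 'I_m.+3 -> K) (s : 'S_m.+3) :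
  (forall i, s (up i) = up i) ->
  \prod_i d i (s i) =
  d o0 (s o0) * (d o1 (s o1) * (d o2 (s o2) * \prod_i d (up i) (up i))).
Proof.
move=> s_up; rewrite !big_ord_recl; do 3 congr (_ * _).
by apply: eq_bigr => i _; rewrite s_up.
Qed.

(* Among the permutations of the first three indices, the even ones have
   0 + 2 + 2 inversions in total and the odd ones 1 + 1 + 3, while both classes
   use each of the nine cells exactly once. *)
Lemma qinv_monomial_weight (K : fieldType) (q c e : K) d : q != 0 ->
  (forall s : 'S_m.+3, q ^+ inversions s = c * e ^+ s * \prod_i d i (s i)) ->
  q = e ^+ 3.
Proof.
move=> q0 qE.
have fix_id i : (1%g : 'S_m.+3) (up i) = up i by rewrite perm1.
have fix01 i : tperm o0 o1 (up i) = up i by rewrite tpermD.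
have fix12 i : tperm o1 o2 (up i) = up i by rewrite tpermD.
have fix02 i : tperm o0 o2 (up i) = up i by rewrite tpermD.
have fixA i : (tperm o0 o1 * tperm o1 o2)%g (up i) = up i.
  by rewrite permM fix01 fix12.
have fixB i : (tperm o1 o2 * tperm o0 o1)%g (up i) = up i.
  by rewrite permM fix12 fix01.
have := qE 1%g; have := qE (tperm o0 o1); have := qE (tperm o1 o2).
have := qE (tperm o0 o2); have := qE (tperm o0 o1 * tperm o1 o2)%g.
have := qE (tperm o1 o2 * tperm o0 o1)%g.
rewrite !inversions_head // !prod_head // !odd_permM !odd_tperm odd_perm1.
rewrite !permM !perm1 !permE /=.
(* The odd product is [q ^+ 5] and the even one [q ^+ 4]; their right-hand sides differ by
   [e ^+ 3]. *)
move=> eB eA e02 e12 e01 e1; have q4 : q ^+ 4 != 0 by rewrite expf_neq0.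
apply: (mulfI q4).
have odd := congr2 *%R (congr2 *%R e02 e12) e01.
have even := congr2 *%R (congr2 *%R eB eA) e1.
rewrite -!exprD in odd even; rewrite -exprSr [LHS]odd.
apply: etrans (congr1 ( *%R^~ (e ^+ 3)) (esym even)).
by ring.
Qed.
End Inversions.

(** * Linear maps carrying one weighted permanent to another *)

Lemma wpermT (K : comNzRingType) n (w : 'S_n -> K) (A : 'M[K]_n) :
  wperm w [set: 'I_n] A = \sum_s w s * \prod_i A i (s i).
Proof.
by apply: eq_bigr => s _; congr (_ * _); apply: eq_bigl => i; rewrite inE.
Qed.

Lemma wperm_monomial (K : comNzRingType) n (w : 'S_n -> K) (A : 'M[K]_n) (s : 'S_n) :
  (forall i j, j != s i -> A i j = 0) ->
  wperm w [set: 'I_n] A = w s * \prod_i A i (s i).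
Proof.
move=> As; rewrite wpermT (bigD1 s) //= [X in _ + X]big1 ?addr0 // => t ts.
have [i tsi] : exists i, t i != s i.
  apply/existsP; apply: contraNT ts => /existsPn ts; apply/eqP/permP => i.
  by have /negPn/eqP := ts i.
by rewrite (bigD1 i) //= As // mul0r mulr0.
Qed.

Section Preservers.
Variables (K : fieldType) (m : nat).
Local Notation n := m.+3.
(** [f] stands for [P_q] and [g] for det or per; [e] is the factor a transposition contributes to
    [w']. *)
Variables (w w' : 'S_n -> K) (e : K) (P : 'rV[K]_n -> Prop).
Variable phi : {linear 'M[K]_n -> 'M[K]_n}.
Let f := wperm w [set: 'I_n].
Let g := wperm w' [set: 'I_n].
Hypothesis w0 : forall s, w s != 0.
Hypothesis w'0 : forall s, w' s != 0.
Hypothesis w'_tperm : forall i k s, i != k -> w' (tperm i k * s)%g = e * w' s.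
Hypothesis g_tr : forall A, g A^T = g A.
Hypothesis g_pencil : forall M : 'I_n -> 'M[K]_n, indep M ->
  (forall x y, polar_minors e (M x) (M y)) ->
  pencil P M \/ pencil P (fun x => (M x)^T).
Hypothesis g_outer : forall (d : 'I_n -> 'I_n -> K) (u v : 'I_n -> 'rV[K]_n),
  (forall i, P (u i)) -> (forall j, P (v j)) -> injective u -> injective v ->
  exists c, forall s : 'S_n,
    g (\sum_i d i (s i) *: ((u i)^T *m v (s i))) = c * e ^+ s * \prod_i d i (s i).
Hypothesis fg : forall X, f X = g (phi X).

(** A matrix [A] in the kernel is flat with every matrix; against a unit outside row [i] and column
    [j] this isolates [w t * A i j]. *)
Lemma preserver_inj : injective phi.
Proof.
apply: raddf_inj => A phiA; apply/matrixP => i j; rewrite mxE.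
pose k := lift i ord0; pose l := lift j ord0.
have ik : i != k := neq_lift _ _; have jl : j != l := neq_lift _ _.
have fA Y : f (Y + A) = f Y by rewrite !fg linearD phiA addr0.
have flA : flat f A (delta_mx k l).
  by move=> Y; rewrite (addrAC Y A) !fA [RHS]addrC.
have [t ti tk] := perm_two_points ik jl.
have := flat_wperm_minor t ik flA; rewrite ti tk !mxE !eqxx.
rewrite (negPf ik) (negPf jl) !(mulr0, mul0r, addr0, andbF) /= mulr1.
by move=> /eqP; rewrite mulf_eq0 (negPf (w0 t)) => /eqP.
Qed.

Lemma preserver_surj Y : exists X, phi X = Y.
Proof.
have ker0 : lker (linfun phi) == 0%VS.
  by apply/lker0P => A B; rewrite !lfunE; apply: preserver_inj.
by exists ((linfun phi)^-1%VF Y); have := lker0_lfunVK ker0 Y; rewrite lfunE.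
Qed.

Lemma preserver_polar i j i' j' : i = i' \/ j = j' ->
  polar_minors e (phi (delta_mx i j)) (phi (delta_mx i' j')).
Proof.
move=> /(flat_wperm_line w) fl a k b l ak bl.
have flg : flat g (phi (delta_mx i j)) (phi (delta_mx i' j')).
  by move=> Y; have [X <-] := preserver_surj Y; rewrite -!linearD -!fg fl.
have [t ta tk] := perm_two_points ak bl.
have := flat_wperm_minor t ak flg; rewrite ta tk w'_tperm // => h.
by apply: (mulfI (w'0 t)); rewrite mulr0 -[RHS]h; ring.
Qed.

Let M i j := phi (delta_mx i j).

Lemma preserver_sum X : phi X = \sum_i \sum_j X i j *: M i j.
Proof.
rewrite {1}[X]matrix_sum_delta linear_sum; apply: eq_bigr => i _.
by rewrite linear_sum; apply: eq_bigr => j _; rewrite linearZ.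
Qed.

Lemma preserver_cell0 i j : M i j != 0.
Proof.
rewrite -(linear0 phi) (inj_eq preserver_inj); apply/matrix0Pn.
by exists i, j; rewrite mxE !eqxx oner_eq0.
Qed.

Lemma preserver_proportional : proportional_free M.
Proof.
move=> i j k l c; rewrite /M -linearZ => /preserver_inj /matrixP/(_ i j).
rewrite !mxE !eqxx; case: eqP => [->|_]; case: eqP => [->|_] //= /eqP;
by rewrite mulr0 oner_eq0.
Qed.

Lemma preserver_indep_row i : indep (M i).
Proof.
move=> u uM x.
have : phi (\sum_y u y *: delta_mx i y) = phi 0.
  by rewrite linear0 -[RHS]uM linear_sum; apply: eq_bigr => y _; rewrite linearZ.
move/preserver_inj/matrixP/(_ i x); rewrite summxE (bigD1 x) //= !mxE !eqxx mulr1.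
rewrite big1 ?addr0 // => y /negPf yx.
by rewrite !mxE eq_sym yx andbF mulr0.
Qed.

Lemma preserver_indep_col j : indep (M^~ j).
Proof.
move=> u uM x.
have : phi (\sum_y u y *: delta_mx y j) = phi 0.
  by rewrite linear0 -[RHS]uM linear_sum; apply: eq_bigr => y _; rewrite linearZ.
move/preserver_inj/matrixP/(_ x j); rewrite summxE (bigD1 x) //= !mxE !eqxx mulr1.
rewrite big1 ?addr0 // => y /negPf yx.
by rewrite !mxE eq_sym yx mulr0.
Qed.

Lemma preserver_not_line (v : 'rV[K]_n) : ~ forall i j, (M i j <= v)%MS.
Proof.
move=> Mv; have [X X1] := preserver_surj 1%:M.
have : (1%:M <= v)%MS.
  rewrite -X1 preserver_sum; apply: summx_sub => i _; apply: summx_sub => j _.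
  exact: scalemx_sub.
by move/mxrankS; rewrite mxrank1 => /leq_trans/(_ (rank_leq_row _)).
Qed.

Lemma preserver_not_line_tr (v : 'rV[K]_n) : ~ forall i j, ((M i j)^T <= v)%MS.
Proof.
move=> Mv; have [X X1] := preserver_surj 1%:M.
have : (1%:M^T <= v)%MS.
  rewrite -X1 preserver_sum linear_sum; apply: summx_sub => i _.
  rewrite linear_sum; apply: summx_sub => j _.
  by rewrite linearZ /=; apply: scalemx_sub.
by rewrite trmx1 => /mxrankS; rewrite mxrank1 => /leq_trans/(_ (rank_leq_row _)).
Qed.

Lemma preserver_weight : exists c (d : 'I_n -> 'I_n -> K),
  forall s : 'S_n, w s = c * e ^+ s * \prod_i d i (s i).
Proof.
have rows i : pencil P (M i) \/ pencil P (fun j => (M i j)^T).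
  apply: g_pencil => [|x y]; first exact: preserver_indep_row.
  by apply: preserver_polar; left.
have cols j : pencil P (M^~ j) \/ pencil P (fun i => (M i j)^T).
  apply: g_pencil => [|x y]; first exact: preserver_indep_col.
  by apply: preserver_polar; right.
have [d [u Pu [v Pv dM]]] := grid_rank1_or_tr ord0 preserver_cell0
  preserver_proportional rows cols preserver_not_line preserver_not_line_tr.
(* Equal outer products would make two cells of the grid proportional; this yields the injectivity
   of [u] and [v]. *)
have share i j k l : (u i)^T *m v j = (u k)^T *m v l -> i = k /\ j = l.
  move=> uv; have d0 : d k l != 0.
    apply: contraNneq (preserver_cell0 k l) => d0.
    case: dM => dM; first by rewrite dM d0 scale0r.
    by rewrite -trmx_eq0 dM d0 scale0r.
  have scal A : d i j *: A = (d i j / d k l) *: (d k l *: A) :> 'M[K]_n.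
    by rewrite scalerA divfK.
  apply: (preserver_proportional (c := d i j / d k l)).
  case: dM => dM; first by rewrite !dM -uv -scal.
  by apply: trmx_inj; rewrite linearZ /= !dM -uv -scal.
have inju : injective u.
  by move=> i k uik; have [] := share i ord0 k ord0 _; rewrite ?uik.
have injv : injective v.
  by move=> j l vjl; have [] := share ord0 j ord0 l _; rewrite ?vjl.
have [c gc] := g_outer d Pu Pv inju injv.
exists c, d => s; rewrite -gc.
(* Permutation matrices read off the weights on both sides. *)
have -> : w s = f (perm_mx s).
  rewrite /f (wperm_monomial _ (s := s)) => [|i j /negPf js].
    by rewrite big1 ?mulr1 // => i _; rewrite !mxE eqxx.
  by rewrite !mxE eq_sym js.
have phis : phi (perm_mx s) = \sum_i M i (s i).
  rewrite preserver_sum; apply: eq_bigr => i _.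
  rewrite (bigD1 (s i)) //= !mxE eqxx scale1r big1 ?addr0 // => j /negPf js.
  by rewrite !mxE eq_sym js scale0r.
rewrite fg phis; case: dM => dM; first by congr g; apply: eq_bigr => i _.
by rewrite -g_tr linear_sum; congr g; apply: eq_bigr => i _ /=.
Qed.
End Preservers.

(** * The determinant and the permanent as instances *)

Lemma det_wperm (K : comNzRingType) n (A : 'M[K]_n) :
  \det A = wperm (fun s : 'S_n => (-1) ^+ s) [set: 'I_n] A.
Proof. by rewrite wpermT. Qed.

Lemma permanent_wperm (K : comNzRingType) n (A : 'M[K]_n) :
  permanent A = wperm (fun=> 1) [set: 'I_n] A.
Proof. by rewrite wpermT; apply: eq_bigr => s _; rewrite mul1r. Qed.

Lemma permanent_tr (K : comNzRingType) n (A : 'M[K]_n) :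
  permanent A^T = permanent A.
Proof.
rewrite /permanent (reindex_inj invg_inj) /=; apply: eq_bigr => s _.
rewrite (reindex_inj (@perm_inj _ s)) /=; apply: eq_bigr => i _.
by rewrite mxE permK.
Qed.

Lemma det_outer_sum (K : comNzRingType) n (d : 'I_n -> 'I_n -> K)
    (u v : 'I_n -> 'rV[K]_n) (s : 'S_n) :
  \det (\sum_i d i (s i) *: ((u i)^T *m v (s i))) =
  \det (\matrix_i u i) * \det (\matrix_j v j) * (-1) ^+ s * \prod_i d i (s i).
Proof.
(* The sum factors through the matrices with rows [u i] and [v j], a diagonal matrix and
   [perm_mx s]. *)
have -> : \sum_i d i (s i) *: ((u i)^T *m v (s i)) =
    (\matrix_i u i)^T *m (diag_mx (\row_i d i (s i)) *m (perm_mx s *m \matrix_j v j)).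
  apply/matrixP => a b; rewrite -row_permE mul_diag_mx summxE !mxE.
  by apply: eq_bigr => i _; rewrite !mxE big_ord1 !mxE mulrCA.
rewrite !det_mulmx det_tr det_diag det_perm.
rewrite (eq_bigr (fun i => d i (s i))) => [|i _]; last by rewrite mxE.
by rewrite -!mulrA; congr (_ * _); rewrite mulrC -mulrA mulrCA.
Qed.

Lemma permanent_outer_sum (K : comNzRingType) n (d : 'I_n -> 'I_n -> K)
    (u v : 'I_n -> 'rV[K]_n) (s : 'S_n) :
  (forall i, exists c, u i = delta_mx 0 c) ->
  (forall j, exists c, v j = delta_mx 0 c) -> injective u -> injective v ->
  permanent (\sum_i d i (s i) *: ((u i)^T *m v (s i))) = \prod_i d i (s i).
Proof.
move=> /fin_all_exists[p up] /fin_all_exists[r vr] uI vI.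
have pI : injective p by move=> i j pij; apply: uI; rewrite !up pij.
have rI : injective r by move=> i j rij; apply: vI; rewrite !vr rij.
set N := \sum_i _.
have NE i b : N (p i) b = d i (s i) *+ (b == r (s i)).
  rewrite summxE (bigD1 i) //= big1 ?addr0 => [|k ki].
    by rewrite up vr trmx_delta mul_delta_mx !mxE eqxx mulr_natr.
  by rewrite up vr trmx_delta mul_delta_mx !mxE (inj_eq pI) eq_sym (negPf ki) mulr0.
(* [N] is a monomial matrix supported on the cells [(p i, r (s i))], the graph of [t]. *)
pose t := ((perm pI)^-1 * s * perm rI)%g.
have tp i : t (p i) = r (s i) by rewrite !permM -(permE pI i) permK permE.
rewrite permanent_wperm (@wperm_monomial _ _ _ _ t) => [|a b].
  rewrite mul1r (reindex_inj pI) /=; apply: eq_bigr => i _.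
  by rewrite tp NE eqxx.
rewrite -[a](permKV (perm pI)) permE; set i := (perm pI)^-1%g a.
by rewrite tp NE => /negPf ->.
Qed.

Theorem theorem2p1 (R : realType) (n : nat) (q : R[i]) :
  (3 <= n)%N -> q != 0 -> q != -1 -> q != 1 ->
  (~ exists phi : {linear 'M[R[i]]_n -> 'M[R[i]]_n},
       forall X : 'M[R[i]]_n, qpermanent q X = \det (phi X)) /\
  (~ exists phi : {linear 'M[R[i]]_n -> 'M[R[i]]_n},
       forall X : 'M[R[i]]_n, qpermanent q X = permanent (phi X)).

Proof.
case: n => [|[|[|m]]] // _ q0 qN1 q1.
have two0 : 2%:R != 0 :> R[i] by rewrite pnatr_eq0.
have qpermE X : qpermanent q X = wperm (fun s => q ^+ inversions s) [set: 'I_m.+3] X.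
  by rewrite wpermT.
have qs0 (s : 'S_m.+3) : q ^+ inversions s != 0 by rewrite expf_neq0.
split=> -[phi phiP].
  (* For det, [e = -1] and the conclusion is [q = (-1) ^+ 3]. *)
  have [s||A|M indM pM|d u v _ _ _ _|X|c [d qE]] := @preserver_weight _ _
      (fun s => q ^+ inversions s) (fun s => (-1) ^+ s) (-1) (fun=> True) phi qs0.
  - by rewrite signr_eq0.
  - by move=> i k s ik; rewrite odd_permM odd_tperm ik signr_addb expr1.
  - by rewrite -!det_wperm det_tr.
  - by apply: det_pencil => //; exact: indep_neq0.
  - by eexists => s; rewrite -det_wperm det_outer_sum.
  - by rewrite -qpermE phiP det_wperm.
  by move/eqP: qN1; apply; rewrite (qinv_monomial_weight q0 qE); ring.
(* For per, [e = 1] and the pencils are spanned by standard basis vectors, whence [q = 1]. *)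
have [s||A|M indM pM|d u v uP vP uI vI|X|c [d qE]] := @preserver_weight _ _
    (fun s => q ^+ inversions s) (fun=> 1) 1
    (fun v => exists c, v = delta_mx 0 c) phi qs0.
- by rewrite oner_eq0.
- by move=> i k s ik; rewrite mulr1.
- by rewrite -!permanent_wperm permanent_tr.
- exact: per_pencil.
- by exists 1 => s; rewrite -permanent_wperm permanent_outer_sum // expr1n !mul1r.
- by rewrite -qpermE phiP permanent_wperm.
by move/eqP: q1; apply; rewrite (qinv_monomial_weight q0 qE) expr1n.
Qed.
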